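(* In a coset diagram for $\Gamma\alpha$, where $\alpha$ is an ambiguous number, the ambiguous numbers form a closed path.
   Context: The Picard group $\Gamma=PSL(2,\mathbb{Z}[i])$ is the group of linear fractional transformations $T(z)=\frac{az+b}{cz+d}$ with $a,b,c,d\in\mathbb{Z}[i]$ and $ad-bc=1$. It has the finite presentation $\langle A,B,C,D : A^3=B^2=C^3=D^2=(AC)^2=(AD)^2=(BC)^2=(BD)^2=1\rangle$, where $A(z)=\frac{1}{z-i}$, $B(z)=\frac1z$, $C(z)=\frac{1+z}{-z}$, $D(z)=\frac{-1}{z}$. The group $\Gamma$ acts on the biquadratic field $\mathbb{Q}(i,\sqrt3)$, and $\Gamma\alpha$ denotes the orbit of $\alpha\in\mathbb{Q}(i,\sqrt3)$ under this action. A real quadratic irrational number $\alpha=\frac{a+b\sqrt3}{c}\in\mathbb{Q}(i,\sqrt3)$, where $a,b,c\in\mathbb{Z}$, is called an ambiguous number when $\alpha$ and its conjugate over $\mathbb{Q}(i)$, $\bar\alpha=\frac{a-b\sqrt3}{c}$, have opposite signs. The coset diagram for the orbit $\Gamma\alpha$ has the elements of $\Gamma\alpha$ as vertices. The 3-cycles of $C$ are represented by triangles with three unbroken edges, permuted anticlockwise. The 3-cycles of $A$ are represented by triangles with three broken edges, permuted anticlockwise. The 2-cycles of $B$ are represented by bold edges, and two vertices interchanged by $D$ are joined by an (ordinary) edge. Fixed points of $A,B,C,D$, if they exist, are denoted by heavy dots. A closed path all of whose vertices are ambiguous numbers is called a closed path of ambiguous numbers. *)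

(* Defs.v *)
From mathcomp Require Import all_boot all_order all_algebra all_field.

Set Implicit Arguments.
Unset Strict Implicit.
Unset Printing Implicit Defensive.

Import Order.TTheory GRing.Theory Num.Theory.
Local Open Scope ring_scope.

(* Q(i, sqrt 3) is taken inside the algebraic numbers algC, where x < y holds
   only when y - x is a positive real. *)

Definition gaussian_int : {pred algC} :=
  [pred z | ('Re z \is a Num.int) && ('Im z \is a Num.int)].

Definition linear_fractional (a b c d z : algC) : algC :=
  (a * z + b) / (c * z + d).

(* Elements of PSL(2, Z[i]) as transformations, so that proportional matrices
   are identified.  The pole of T (where division by 0 gives the value 0) is in
   Q(i), hence never occurs in the orbit of a number outside Q(i). *)
Definition Picard (T : algC -> algC) : Prop :=
  exists a b c d : algC,
    [/\ [&& a \in gaussian_int, b \in gaussian_int,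
            c \in gaussian_int & d \in gaussian_int],
        a * d - b * c = 1
      & T =1 linear_fractional a b c d].

Definition Picard_orbit (alpha z : algC) : Prop :=
  exists2 T, Picard T & z = T alpha.

(* Multiplying numerator and denominator by 'i gives the generators A and B
   representatives of determinant 1. *)
Definition genA (z : algC) : algC := 1 / (z - 'i).
Definition genB (z : algC) : algC := 1 / z.
Definition genC (z : algC) : algC := (1 + z) / (- z).
Definition genD (z : algC) : algC := - 1 / z.

Definition opposite_signs (x y : algC) : bool :=
  (x < 0) && (0 < y) || (0 < x) && (y < 0).

(* b != 0 is the irrationality of alpha. *)
Definition ambiguous (alpha : algC) : Prop :=
  exists a b c : int,
    [/\ b != 0, c != 0,
        alpha = (a%:~R + b%:~R * sqrtC 3) / c%:~R
      & opposite_signs ((a%:~R + b%:~R * sqrtC 3) / c%:~R)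
                       ((a%:~R - b%:~R * sqrtC 3) / c%:~R)].

(* The edges of the coset diagram: each edge can be followed in both
   directions, and fixed points are dots, not loops. *)
Definition coset_edge : rel algC := fun x y =>
  (x != y) &&
  [|| y == genA x, x == genA y, y == genB x, x == genB y,
      y == genC x, x == genC y, y == genD x | x == genD y].

(* p lists once each the successive vertices of the path, the last one being
   joined to the first; 2 < size p excludes a single edge traversed back and
   forth. *)
Definition closed_path (alpha : algC) (p : seq algC) : Prop :=
  [/\ (2 < size p)%N, forall z, z \in p -> Picard_orbit alpha z
    & ucycle coset_edge p].

Definition closed_path_of_ambiguous (alpha : algC) (p : seq algC) : Prop :=
  closed_path alpha p /\ forall z, z \in p -> ambiguous z.

(* Main.v *)
Require Import Defs.
From mathcomp Require Import all_boot all_order all_algebra all_field.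
From mathcomp Require Import ring zify.

Set Implicit Arguments.
Unset Strict Implicit.
Unset Printing Implicit Defensive.

Import Order.TTheory GRing.Theory Num.Theory.
Local Open Scope ring_scope.

(** Write z' for the conjugate of z over Q(i); an ambiguous number is a z in
    Q(sqrt 3) such that z and z' have opposite signs.

    On ambiguous numbers the coset diagram is a cubic graph.  The generator A
    sends no nonzero real number to a real number.  B preserves the signs of z
    and z' and D changes both; being commuting involutions, they cut the
    ambiguous numbers into squares z, 1/z, -z, -1/z.  C permutes cyclically the
    three arcs cut out of the real projective line by -1, 0 and oo; as z and z'
    lie in different arcs, one of them in (0, oo), exactly two of the three
    points of the triangle of z are ambiguous, so C contributes one more edge
    at z.  From a positive z this edge leads to -1/(1+z) if z' < -1 and to
    -1-1/z otherwise.

    Hence the map [step], which follows the D-edge from a negative number and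
    the C-edge from a positive one, is a well defined injection of the
    ambiguous numbers, and it commutes with inversion, that is with B: the
    diagram is a closed ladder whose rungs are the B-edges {z, 1/z} and whose
    sides are the orbits of [step].  Since [step] preserves the discriminant
    b^2 - 4ac of the minimal quadratic form, and ac < 0 for an ambiguous root,
    it moves inside a finite set, so some iterate brings alpha back to the
    rung {alpha, 1/alpha}; let n be the first positive exponent with this
    property.  Going up one side of the n rungs and down the other side gives
    the closed path:
      alpha, step alpha, ..., step^(n-1) alpha,
      step^(n-1) (1/alpha), ..., step (1/alpha), 1/alpha.

    It remains to see that no ambiguous number of the orbit is left out.
    First, a Gaussian matrix M1 + i M2 of determinant 1 that sends alpha to
    another ambiguous number is real or purely imaginary
    ([Picard_orbit_real]), so an integer matrix of determinant 1 or -1 does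
    the same.  Second, the set of vertices of the path is stable under [step]
    in both directions and under inversion, and such a set is a union of
    GL_2(Z)-classes of ambiguous numbers ([invariant_GL2Z]): the ambiguity of
    the two numbers forces the signs in the matrix, up to the symmetries of
    the squares, to be those of a matrix with nonnegative entries, and
    Euclid's algorithm on its rows writes such a matrix as a product of moves
    along the ladder. *)

(** * Conjugation over Q(i) *)

(** Extending the conjugation to all algebraic numbers makes it a ring
    morphism defined everywhere.  It is found in the action of
    Gal(Q(zeta_12)/Q): raising to the power 5 fixes i (a fourth root of unity)
    and exchanges the two primitive cube roots of unity (-1 +- i sqrt 3) / 2. *)
Lemma conj3_exists :
  {u : {rmorphism algC -> algC} | u (sqrtC 3) = - sqrtC 3}.
Proof.
have [u uX] := @Qn_aut_exists 5 12 isT; exists u.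
have ui : u 'i = 'i.
  have i4 : 'i ^+ 4 = 1 :> algC by rewrite (exprM _ 2 2) sqrCi; ring.
  by rewrite uX ?(exprM _ 4 3) ?i4 ?expr1n // exprS i4 mulr1.
have i2 : 'i ^+ 2 = -1 :> algC := sqrCi _.
have s2 : sqrtC 3 ^+ 2 = 3 :> algC := sqrtCK _.
have nz2 : (2 : algC) != 0 by rewrite pnatr_eq0.
pose w : algC := (-1 + 'i * sqrtC 3) / 2.
have w2 : w ^+ 2 = -1 - w.
  have -> : w ^+ 2 = (1 - 2 * 'i * sqrtC 3 + 'i ^+ 2 * sqrtC 3 ^+ 2) / 4.
    by rewrite /w; field.
  by rewrite i2 s2 /w; field.
have w3 : w ^+ 3 = 1 by rewrite exprS w2 mulrBr -expr2 w2; ring.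
have uw : u w = -1 - w.
  by rewrite uX ?(exprM _ 3 4) ?w3 ?expr1n // (exprD _ 3 2) w3 w2 mul1r.
have is3 : 'i * sqrtC 3 = 2 * w + 1 by rewrite /w; field.
apply: (mulfI (neq0Ci _)); rewrite mulrN is3 -[in LHS]ui -rmorphM is3.
by rewrite rmorphD rmorphM rmorph1 rmorph_nat uw; ring.
Qed.

Definition conj3 : {rmorphism algC -> algC} := sval conj3_exists.

Lemma conj3_sqrt3 : conj3 (sqrtC 3) = - sqrtC 3.
Proof. exact: (svalP conj3_exists). Qed.

Definition Qsqrt3 (z : algC) : Prop :=
  exists p q : rat, z = ratr p + ratr q * sqrtC 3.

Lemma conj3_Qsqrt3 (p q : rat) :
  conj3 (ratr p + ratr q * sqrtC 3) = ratr p - ratr q * sqrtC 3.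
Proof.
by rewrite rmorphD [conj3 (ratr q * _)]rmorphM /= !fmorph_rat conj3_sqrt3 mulrN.
Qed.

Lemma Qsqrt3_opp z : Qsqrt3 z -> Qsqrt3 (- z).
Proof.
by move=> [p [q ->]]; exists (- p), (- q); rewrite !rmorphN /=; ring.
Qed.

Lemma Qsqrt3_add1 z : Qsqrt3 z -> Qsqrt3 (1 + z).
Proof.
by move=> [p [q ->]]; exists (1 + p), q; rewrite rmorphD rmorph1 addrA.
Qed.

Lemma Qsqrt3_inv z : Qsqrt3 z -> Qsqrt3 z^-1.
Proof.
move=> [p [q defz]]; have [->|nz_z] := eqVneq z 0.
  by exists 0, 0; rewrite invr0 !rmorph0 mul0r addr0.
have s2 : sqrtC 3 ^+ 2 = 3 :> algC := sqrtCK _.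
pose n := p ^+ 2 - 3 * q ^+ 2.
have defn : z * conj3 z = ratr n.
  rewrite defz conj3_Qsqrt3 mulrC -subr_sqr [(_ * sqrtC 3) ^+ 2]exprMn s2 /n.
  by rewrite rmorphB (rmorphM _ 3) !rmorphXn rmorph_nat (mulrC 3).
have nz_n : ratr n != 0 :> algC by rewrite -defn mulf_eq0 fmorph_eq0 orbb.
have -> : z^-1 = conj3 z / ratr n.
  by rewrite -defn invfM mulrCA mulfV ?mulr1 ?fmorph_eq0.
exists (p / n), (- q / n); rewrite defz conj3_Qsqrt3 !fmorph_div rmorphN /=.
by field.
Qed.

Lemma Qsqrt3_real z : Qsqrt3 z -> z \is Num.real.
Proof.
move=> [p [q ->]].
have s_real : sqrtC 3 \is (@Num.real algC).
  by rewrite ger0_real // sqrtC_ge0 ler0n.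
have rat_real (x : rat) : ratr x \is (@Num.real algC).
  by rewrite Creal_Crat ?Crat_rat.
by apply: realD => //; apply: realM.
Qed.

Lemma conj3_Qsqrt3_real z : Qsqrt3 z -> conj3 z \is Num.real.
Proof.
move=> [p [q ->]]; rewrite conj3_Qsqrt3 -mulNr -rmorphN.
by apply: Qsqrt3_real; exists p; exists (- q).
Qed.

(** * Ambiguous numbers *)

(** The working form of [ambiguous], by [ambiguousP]; irrationality is implied,
    as a rational z equals its conjugate. *)
Definition amb (z : algC) : Prop := Qsqrt3 z /\ z * conj3 z < 0.

Lemma amb_neq0 z : amb z -> z != 0.
Proof. by case=> _; apply: contraTneq => ->; rewrite mul0r ltxx. Qed.

Lemma amb_conj3_neq z : amb z -> conj3 z != z.
Proof.
move=> [Kz]; apply: contraTneq => ->.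
have zR := Qsqrt3_real Kz.
by rewrite -expr2 real_ltNge ?real0 ?realX // real_exprn_even_ge0.
Qed.

Lemma amb_signs z : amb z -> z < 0 /\ 0 < conj3 z \/ 0 < z /\ conj3 z < 0.
Proof.
move=> [Kz]; have := Qsqrt3_real Kz; rewrite realE orbC le_eqVlt.
move=> /orP[/orP[/eqP->|z_lt0]|z_ge0].
- by rewrite mul0r ltxx.
- by rewrite nmulr_rlt0 //; left.
- move: z_ge0; rewrite le_eqVlt => /orP[/eqP<-|z_gt0].
    by rewrite mul0r ltxx.
  by rewrite pmulr_rlt0 //; right.
Qed.

Lemma amb_lt0 z : amb z -> z < 0 -> 0 < conj3 z.
Proof. by move=> [_ zz] z_lt0; rewrite -(nmulr_rlt0 _ z_lt0). Qed.

Lemma amb_neg z : Qsqrt3 z -> z < 0 -> 0 < conj3 z -> amb z.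
Proof. by move=> Kz z_lt0 cz_gt0; split; rewrite ?nmulr_rlt0. Qed.

Lemma amb_pos z : Qsqrt3 z -> 0 < z -> conj3 z < 0 -> amb z.
Proof. by move=> Kz z_gt0 cz_lt0; split; rewrite ?pmulr_rlt0. Qed.

Lemma amb_opp z : amb z -> amb (- z).
Proof.
by move=> [Kz zz]; split; [exact: Qsqrt3_opp | rewrite rmorphN mulrNN].
Qed.

Lemma amb_inv z : amb z -> amb z^-1.
Proof.
move=> [Kz zz]; split; first exact: Qsqrt3_inv.
by rewrite fmorphV -invfM invr_lt0.
Qed.

Lemma amb_add1 z : amb z -> 0 < z -> conj3 z < -1 -> amb (1 + z).
Proof.
move=> [Kz _] z_gt0 cz_lt; apply: amb_pos; first exact: Qsqrt3_add1.
  exact: addr_gt0.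
by rewrite rmorphD rmorph1 addrC -ltrBrDr sub0r.
Qed.

Lemma ambiguousP z : ambiguous z <-> amb z.
Proof.
split.
  move=> [a [b [c [b0 c0 defz]]]].
  have Ez (s : algC) : (a%:~R + b%:~R * s) / c%:~R
       = ratr (a%:~R / c%:~R) + ratr (b%:~R / c%:~R) * s.
    by rewrite !fmorph_div /= !ratr_int mulrDl mulrAC.
  rewrite -mulrN !Ez in defz *; rewrite mulrN -conj3_Qsqrt3 -defz.
  have Kz : Qsqrt3 z by rewrite defz; do 2!eexists.
  by case/orP=> /andP[h1 h2]; [apply: amb_neg | apply: amb_pos].
move=> az; have [[p [q defz]] _] := az.
have nz_d (x : rat) : (denq x)%:~R != 0 :> algC by rewrite intr_eq0 denq_neq0.
exists (numq p * denq q), (numq q * denq p), (denq p * denq q).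
have Er (x : rat) : ratr x = (numq x)%:~R / (denq x)%:~R :> algC by [].
have Ez (s : algC) :
    ((numq p * denq q)%:~R + (numq q * denq p)%:~R * s) / (denq p * denq q)%:~R
       = ratr p + ratr q * s.
  by rewrite !intrM !Er; field; rewrite !nz_d.
rewrite -mulrN !Ez mulrN -conj3_Qsqrt3 -defz; split=> //.
- rewrite mulf_neq0 ?denq_neq0 // numq_eq0.
  apply: contraNneq (amb_conj3_neq az) => q0.
  by rewrite defz q0 rmorph0 mul0r addr0 fmorph_rat.
- by rewrite mulf_neq0 ?denq_neq0.
- by apply/orP; case: (amb_signs az) => [][h1 h2]; [left|right]; apply/andP.
Qed.

(** * The walk along the ladder *)

(** The D-edge of a negative number, the C-edge of a positive one. *)
Definition step (z : algC) : algC :=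
  if z < 0 then - z^-1
  else if conj3 z < -1 then - (1 + z)^-1 else - (1 + z^-1).

Variant step_spec (z : algC) : algC -> Prop :=
  | StepNeg of z < 0 & 0 < conj3 z : step_spec z (- z^-1)
  | StepFar of 0 < z & conj3 z < -1 : step_spec z (- (1 + z)^-1)
  | StepNear of 0 < z & conj3 z^-1 < -1 : step_spec z (- (1 + z^-1)).

Lemma conj3V_ltN1 z : conj3 z < 0 -> (conj3 z^-1 < -1) = (-1 < conj3 z).
Proof.
by move=> cz_lt0; rewrite fmorphV invf_nlt ?invrN1 // negrE ltrN10.
Qed.

Lemma stepP z : amb z -> step_spec z (step z).
Proof.
move=> az; rewrite /step; have [[z_lt0 cz_gt0]|[z_gt0 cz_lt0]] := amb_signs az.
  by rewrite z_lt0; constructor.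
have Kcz := conj3_Qsqrt3_real (proj1 az).
rewrite lt_gtF //; case: real_ltgtP => // [| cz_lt | cz_gt | czN1].
- by rewrite realN real1.
- by constructor.
- by constructor; rewrite ?conj3V_ltN1.
have z1 : z = -1 by apply: (fmorph_inj conj3); rewrite rmorphN rmorph1.
by rewrite z1 oppr_gt0 ltr10 in z_gt0.
Qed.

(** [step] is composed of opposites, inversions and of the translation by 1 in
    the case where it does not spoil ambiguity. *)
Lemma step_preserves (Q : algC -> Prop) :
  (forall z, amb z -> Q z -> Q (- z)) ->
  (forall z, amb z -> Q z -> Q z^-1) ->
  (forall z, amb z -> 0 < z -> conj3 z < -1 -> Q z -> Q (1 + z)) ->
  forall z, amb z -> Q z -> Q (step z).
Proof.
move=> Qopp Qinv Qadd1 z az Qz.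
case: (stepP az) => [_ _ | z_gt0 cz_lt | z_gt0 cz_lt].
- by apply: Qopp (amb_inv az) _; apply: Qinv.
- have az1 := amb_add1 az z_gt0 cz_lt.
  by apply: Qopp (amb_inv az1) _; apply: Qinv => //; apply: Qadd1.
- have avi := amb_inv az; have vi_gt0 : 0 < z^-1 by rewrite invr_gt0.
  apply: Qopp (amb_add1 avi vi_gt0 cz_lt) _.
  by apply: Qadd1 => //; apply: Qinv.
Qed.

Lemma amb_step z : amb z -> amb (step z).
Proof.
move=> az; apply: (@step_preserves amb) (az) => // x.
- by move=> _; apply: amb_opp.
- by move=> _; apply: amb_inv.
- by move=> _ x_gt0 cx_lt ax; apply: amb_add1.
Qed.

(** Inversion exchanges the cases z' < -1 and -1 < z' < 0 of a positive z. *)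
Lemma step_inv z : amb z -> step z^-1 = (step z)^-1.
Proof.
move=> az; have := stepP (amb_inv az); have := stepP az.
case=> h1 h2; case;
  rewrite ?invr_gt0 ?invr_lt0 ?invrK ?invrN ?invrK // => h3 h4.
- by rewrite (lt_gtF h1) in h3.
- by rewrite (lt_gtF h1) in h3.
- by rewrite (lt_gtF h1) in h3.
- rewrite conj3V_ltN1 in h4; first by rewrite (lt_gtF h4) in h2.
  by rewrite (lt_trans h2) // ltrN10.
- by rewrite (lt_gtF h1) in h3.
- move: h2; rewrite conj3V_ltN1; first by move/lt_gtF; rewrite h4.
  by rewrite (lt_trans h4) // ltrN10.
Qed.

Lemma step_sign z : amb z -> (step z < 0) = ~~ (z < 0).
Proof.
case/stepP=> h1 _; rewrite oppr_lt0 ?invr_gt0.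
- by rewrite h1 lt_gtF.
- by rewrite (lt_gtF h1) addr_gt0.
- by rewrite (lt_gtF h1) addr_gt0 ?invr_gt0.
Qed.

(** The two values that [step] can take at positive numbers are separated
    by -1. *)
Lemma step_inj z w : amb z -> amb w -> step z = step w -> z = w.
Proof.
have mixed x y : 0 < x -> 0 < y -> (1 + x)^-1 != 1 + y^-1 :> algC.
  move=> x_gt0 y_gt0; have x1_gt0 : 0 < 1 + x by rewrite addr_gt0.
  by rewrite lt_eqF // (@lt_trans _ _ 1) ?invf_lt1 ?ltrDl ?invr_gt0.
move=> az aw eq_zw.
have := step_sign az; rewrite eq_zw (step_sign aw) => /esym sg.
move: eq_zw; have := stepP aw; have := stepP az.
case=> h1 h2; case=> h3 h4 /oppr_inj; move: sg;
  rewrite ?h1 ?h3 ?(lt_gtF h1) ?(lt_gtF h3) // => _.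
- exact: invr_inj.
- by move/invr_inj/addrI.
- by move/eqP; rewrite (negbTE (mixed _ _ h1 h3)).
- by move/esym/eqP; rewrite (negbTE (mixed _ _ h3 h1)).
- by move/addrI/invr_inj.
Qed.

Lemma coset_edge_sym : symmetric coset_edge.
Proof.
by move=> x y; rewrite /coset_edge eq_sym; congr (_ && _);
   do !case: (_ == _).
Qed.

Lemma coset_edge_step z : amb z -> coset_edge z (step z).
Proof.
move=> az; apply/andP; split.
  by apply: contra_eqN (step_sign az) => /eqP <-; case: (z < 0).
have z0 := amb_neq0 az.
case: (stepP az) => [_ _ | z_gt0 cz_lt | z_gt0 cz_lt].
- suff -> : - z^-1 == genD z by rewrite !orbT.
  by rewrite /genD mulN1r.
- have z1 := amb_neq0 (amb_add1 az z_gt0 cz_lt).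
  suff -> : z == genC (- (1 + z)^-1) by rewrite !orbT.
  by rewrite /genC opprK invrK mulrDl mul1r mulNr mulVf // addrAC subrr add0r.
- suff -> : - (1 + z^-1) == genC z by rewrite !orbT.
  by rewrite /genC invrN mulrN mulrDl mul1r divff // addrC.
Qed.

Lemma amb_inv_neq z : amb z -> z^-1 != z.
Proof.
move=> az; have z0 := amb_neq0 az; apply: contra (amb_conj3_neq az) => /eqP zV.
have : z ^+ 2 == 1 ^+ 2 by rewrite expr2 -{1}zV mulVf // expr1n.
by rewrite eqf_sqr => /orP[]/eqP->; rewrite ?rmorphN rmorph1.
Qed.

Lemma coset_edge_inv z : amb z -> coset_edge z z^-1.
Proof.
move=> az; rewrite /coset_edge eq_sym amb_inv_neq //=.
by rewrite /genB mul1r eqxx !orbT.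
Qed.

(** * Finiteness and periodicity *)

Definition has_disc (D : int) (z : algC) : Prop :=
  exists a b c : int, [/\ a != 0, a%:~R * z ^+ 2 + b%:~R * z + c%:~R = 0
                        & b ^+ 2 - 4 * a * c = D].

Lemma int_affine_eq0 (m n : int) z :
  conj3 z != z -> m%:~R * z + n%:~R = 0 -> m = 0 /\ n = 0.
Proof.
move=> z_irr mzn; have cmzn : m%:~R * conj3 z + n%:~R = 0.
  by move/(congr1 conj3): mzn; rewrite rmorphD rmorphM !rmorph_int rmorph0.
have : m%:~R * (conj3 z - z) = 0.
  rewrite (_ : _ * _ = (m%:~R * conj3 z + n%:~R) - (m%:~R * z + n%:~R));
    last by ring.
  by rewrite cmzn mzn subrr.
move/eqP; rewrite mulf_eq0 subr_eq0 (negPf z_irr) orbF intr_eq0 => /eqP m0.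
by move: mzn; rewrite m0 mul0r add0r => /eqP; rewrite intr_eq0 => /eqP.
Qed.

Lemma has_disc_opp D z : has_disc D z -> has_disc D (- z).
Proof.
move=> [a [b [c [a0 abc defD]]]]; exists a, (- b), c; split=> //.
  by rewrite -abc rmorphN /=; ring.
by rewrite sqrrN.
Qed.

Lemma has_disc_inv D z : amb z -> has_disc D z -> has_disc D z^-1.
Proof.
move=> az [a [b [c [a0 abc defD]]]]; have z0 := amb_neq0 az.
exists c, b, a; split; last by rewrite -defD; ring.
- apply: contraNneq a0 => c0; move: abc; rewrite c0 addr0 expr2 mulrA -mulrDl.
  move/eqP; rewrite mulf_eq0 (negPf z0) orbF => /eqP.
  by move/(int_affine_eq0 (amb_conj3_neq az))=> [->].
- apply: (mulfI (expf_neq0 2 z0)); rewrite mulr0 -abc; field; exact: z0.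
Qed.

Lemma has_disc_add1 D z : has_disc D z -> has_disc D (1 + z).
Proof.
move=> [a [b [c [a0 abc defD]]]]; exists a, (b - 2 * a), (a - b + c).
split=> //; last by rewrite -defD; ring.
by rewrite -abc !(rmorphD, rmorphB, rmorphM) /=; ring.
Qed.

Lemma has_disc_step D z : amb z -> has_disc D z -> has_disc D (step z).
Proof.
apply: step_preserves => x ax; last by move=> _ _; apply: has_disc_add1.
  exact: has_disc_opp.
exact: has_disc_inv.
Qed.

Lemma amb_has_disc z : amb z -> exists D, has_disc D z.
Proof.
move/ambiguousP=> [a [b [c [b0 c0 defz _]]]].
have c0' : c%:~R != 0 :> algC by rewrite intr_eq0.
have s2 : sqrtC 3 ^+ 2 = 3 :> algC := sqrtCK _.
(* c^2 X^2 - 2 a c X + (a^2 - 3 b^2) vanishes at (a + b sqrt 3) / c. *)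
do 4!eexists; split; last reflexivity.
  exact: (expf_neq0 2 c0).
instantiate (1 := a ^+ 2 - 3 * b ^+ 2); instantiate (1 := - 2 * a * c).
rewrite defz !(rmorphD, rmorphB, rmorphN, rmorphM, rmorphXn) /=.
set s := sqrtC 3 in s2 *.
suff : (a%:~R + b%:~R * s) ^+ 2 - 2 * a%:~R * (a%:~R + b%:~R * s)
       + (a%:~R ^+ 2 - 3 * b%:~R ^+ 2) = 0.
  by move=> <-; field.
by rewrite -s2; ring.
Qed.

(** c / a is the norm z z', which is negative, so that b^2 and -4ac add up to D
    without cancellation. *)
Lemma disc_bound (D a b c : int) z :
  amb z -> a != 0 -> a%:~R * z ^+ 2 + b%:~R * z + c%:~R = 0 ->
  b ^+ 2 - 4 * a * c = D -> (`|a| <= `|D| /\ `|b| <= `|D|)%N.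
Proof.
move=> az a0 abc defD.
have ac_lt0 : a * c < 0.
  rewrite -(ltrz0 algC) intrM.
  have cabc : a%:~R * conj3 z ^+ 2 + b%:~R * conj3 z + c%:~R = 0.
    move/(congr1 conj3): abc.
    rewrite !rmorphD [conj3 (a%:~R * _)]rmorphM rmorphXn.
    by rewrite [conj3 (b%:~R * _)]rmorphM !rmorph_int rmorph0.
  have defc : c%:~R = a%:~R * (z * conj3 z).
    have d0 : conj3 z - z != 0 by rewrite subr_eq0 amb_conj3_neq.
    apply: (mulfI d0); apply/eqP; rewrite -subr_eq0.
    rewrite (_ : _ - _ = conj3 z * (a%:~R * z ^+ 2 + b%:~R * z + c%:~R)
        - z * (a%:~R * conj3 z ^+ 2 + b%:~R * conj3 z + c%:~R)); last by ring.
    by rewrite abc cabc !mulr0 subrr.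
  rewrite defc mulrA -expr2 pmulr_rlt0 ?(proj2 az) //.
  by rewrite lt_def sqrf_eq0 intr_eq0 a0 -rmorphXn ler0z sqr_ge0.
rewrite -{}defD expr2.
have b_le : `|b| <= b * b by case: (lerP 0 b) => h; nia.
have a_le : `|a| <= - (a * c).
  rewrite -(gtr0_norm (_ : 0 < - (a * c))) ?oppr_gt0 // normrN normrM.
  rewrite ler_peMr // -gtz0_ge1 normr_gt0.
  by apply: contraTneq ac_lt0 => ->; rewrite mulr0.
by split; lia.
Qed.

(** A root of a form of discriminant D is determined by a, b and the choice of a
    square root of D, the value of 2 a z + b. *)
Lemma disc_finite D : exists s : seq algC,
  forall z, amb z -> has_disc D z -> z \in s.
Proof.
pose range : seq int := [seq k%:Z - `|D|%:Z | k <- iota 0 `|D|.*2.+1].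
have in_range (m : int) : (`|m| <= `|D|)%N -> m \in range.
  move=> le_mD; apply/mapP; exists `|(m + `|D|%:Z)%R|%N; rewrite ?mem_iota; lia.
pose r : algC := sqrtC D%:~R.
pose root (ab : int * int) (t : algC) : algC := (t - ab.2%:~R) / (2 * ab.1%:~R).
exists [seq root ab t | ab <- [seq (a, b) | a <- range, b <- range],
                        t <- [:: r; - r]].
move=> z az [a [b [c [a0 abc defD]]]].
have [/in_range a_in /in_range b_in] := disc_bound az a0 abc defD.
have nz_a : a%:~R != 0 :> algC by rewrite intr_eq0.
have nz2 : (2 : algC) != 0 by rewrite pnatr_eq0.
have -> : z = root (a, b) (2 * a%:~R * z + b%:~R).
  by rewrite /root /= addrK mulrAC mulfV ?mul1r ?mulf_neq0.
apply: allpairs_f; first exact: allpairs_f.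
rewrite !inE -eqf_sqr sqrtCK -defD -subr_eq0 rmorphB rmorphXn !rmorphM /=.
rewrite (_ : _ - _ = 4 * a%:~R * (a%:~R * z ^+ 2 + b%:~R * z + c%:~R));
  last by ring.
by rewrite abc mulr0.
Qed.

Lemma iter_recurrent (T : eqType) (f : T -> T) (x : T) (s : seq T) :
  (forall n, iter n f x \in s) ->
  exists i j, (i < j)%N /\ iter i f x = iter j f x.
Proof.
move=> in_s; have : looping f x (size s).
  apply: contraT; rewrite -looping_uniq => /uniq_leq_size le_s.
  have /le_s : {subset traject f x (size s).+1 <= s}.
    by move=> _ /trajectP[i _ ->].
  by rewrite size_traject ltnn.
by case/trajectP=> i lt_i eq_i; exists i, (size s).
Qed.

Lemma amb_iter n z : amb z -> amb (iter n step z).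
Proof. by move=> az; elim: n => //= n; apply: amb_step. Qed.

Lemma iter_step_inj n z w :
  amb z -> amb w -> iter n step z = iter n step w -> z = w.
Proof.
move=> az aw; elim: n => //= n IHn /step_inj eq_n.
by apply/IHn/eq_n; apply: amb_iter.
Qed.

Lemma iter_step_sub i j z w : amb z -> amb w -> (i <= j)%N ->
  iter i step z = iter j step w -> iter (j - i) step w = z.
Proof.
move=> az aw le_ij eq_ij.
apply: (@iter_step_inj i) => //; first exact: amb_iter.
by rewrite -iterD subnKC.
Qed.

Lemma step_periodic z : amb z -> exists2 n, (0 < n)%N & iter n step z = z.
Proof.
move=> az; have [D Dz] := amb_has_disc az; have [s in_s] := disc_finite D.
have [n|i [j [lt_ij eq_ij]]] := @iter_recurrent _ step z s.
  apply: in_s; first exact: amb_iter.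
  by elim: n => //= n; apply/has_disc_step/amb_iter.
exists (j - i)%N; first by rewrite subn_gt0.
by apply: iter_step_sub eq_ij => //; apply: ltnW.
Qed.

Lemma iter_step_inv n z : amb z -> iter n step z^-1 = (iter n step z)^-1.
Proof.
by move=> az; elim: n => //= n ->; rewrite step_inv //; apply: amb_iter.
Qed.

(** * The closed path *)

Section HamiltonianCycle.
Variables (z : algC) (n : nat).
Hypotheses (az : amb z) (n_gt0 : (0 < n)%N).
Hypothesis iter_n : iter n step z \in [:: z; z^-1].
Hypothesis n_min : forall m, (0 < m < n)%N -> iter m step z \notin [:: z; z^-1].

(** Up one side of the ladder and down the other.  As the path is closed by the
    rungs {z, 1/z} and {step^(n-1) z, step^(n-1) (1/z)}, it exists both on a
    cylindrical ladder (step^n z = z) and on a Moebius one (step^n z = 1/z). *)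
Definition ladder_cycle := traject step z n ++ rev (traject step z^-1 n).

Let p := ladder_cycle.

Lemma mem_ladder_cycle w :
  reflect (exists2 i, (i < n)%N & w = iter i step z \/ w^-1 = iter i step z)
          (w \in p).
Proof.
rewrite /p /ladder_cycle mem_cat mem_rev; apply: (iffP orP).
  case=> /trajectP[i lt_in ->]; exists i => //; first by left.
  by right; rewrite iter_step_inv // invrK.
case=> i lt_in [->|defw]; [left | right]; apply/trajectP; exists i => //.
by rewrite iter_step_inv // -defw invrK.
Qed.

Lemma ladder_cycle_inv w : (w^-1 \in p) = (w \in p).
Proof.
by apply/mem_ladder_cycle/mem_ladder_cycle => -[i lt_in H]; exists i => //;
  rewrite ?invrK in H *; case: H; auto.
Qed.

Lemma ladder_cycle_amb w : w \in p -> amb w.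
Proof.
case/mem_ladder_cycle=> i _ [->|/(congr1 GRing.inv)]; first exact: amb_iter.
by rewrite invrK => ->; apply/amb_inv/amb_iter.
Qed.

(** Off the ends this is a shift of the exponent; at the ends, [iter_n] closes
    the ladder. *)
Lemma ladder_cycle_step w : amb w -> (step w \in p) = (w \in p).
Proof.
have step_iter x i : amb x -> (i < n)%N -> x = iter i step z -> step x \in p.
  move=> ax lt_in defx; have [eq_n|] := eqVneq i.+1 n; last first.
    move=> ne_n; apply/mem_ladder_cycle; exists i.+1; last by rewrite defx; left.
    by rewrite ltn_neqAle ne_n.
  move: iter_n; rewrite -eq_n /= -defx !inE => /orP[]/eqP->;
    apply/mem_ladder_cycle.
    by exists 0%N => //; left.
  by exists 0%N => //; right; rewrite invrK.
have iter_step x i : amb x -> (i < n)%N -> step x = iter i step z -> x \in p.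
  move=> ax; case: i => [_ /= stepx | i lt_in /= /step_inj defx].
    have ltp_n : (n.-1 < n)%N by rewrite prednK.
    have : step (iter n.-1 step z) \in [:: step x; step x^-1].
      by rewrite step_inv // stepx -iterS prednK.
    have alast := amb_iter n.-1 az.
    rewrite !inE => /orP[]/eqP/step_inj last_eq; apply/mem_ladder_cycle;
      exists n.-1 => //; first by left; rewrite last_eq.
    by right; rewrite last_eq //; apply: amb_inv.
  apply/mem_ladder_cycle; exists i; first exact: ltnW.
  by left; rewrite defx //; apply: amb_iter.
move=> aw; apply/idP/idP => /mem_ladder_cycle[i lt_in [defw|defw]].
- exact: iter_step defw.
- rewrite -ladder_cycle_inv; apply: iter_step lt_in _; first exact: amb_inv.
  by rewrite step_inv.
- exact: step_iter defw.
- rewrite -ladder_cycle_inv -step_inv //.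
  by apply: step_iter lt_in defw; apply: amb_inv.
Qed.

(** n is not 1, as [step] changes the sign, which z and 1/z share. *)
Lemma ladder_cycle_size : (2 < size p)%N.
Proof.
rewrite /p /ladder_cycle size_cat size_rev !size_traject addnn.
suff : (1 < n)%N by case: (n) => [|[|k]].
rewrite ltn_neqAle n_gt0 andbT; apply: contraTneq iter_n => <- /=.
have sg := step_sign az; rewrite !inE negb_or; apply/andP; split.
  by apply: contra_eqN sg => /eqP->; case: (z < 0).
by apply: contra_eqN sg => /eqP->; rewrite invr_lt0; case: (z < 0).
Qed.

(** A repetition within a side, or between the sides, would bring z back to
    {z, 1/z} in less than n steps. *)
Lemma ladder_cycle_uniq : uniq p.
Proof.
have uniq_traj x : amb x -> (forall m, (0 < m < n)%N -> iter m step x != x) ->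
    uniq (traject step x n).
  move=> ax min_x; case Dn: n => [|k] //; rewrite looping_uniq.
  apply/trajectP=> -[i lt_ik eq_ik].
  have := iter_step_sub ax ax (ltnW lt_ik) (esym eq_ik); apply/eqP/min_x.
  by rewrite subn_gt0 lt_ik Dn ltnS leq_subr.
have min_z m : (0 < m < n)%N -> iter m step z != z /\ iter m step z != z^-1.
  by move/n_min; rewrite !inE negb_or => /andP.
rewrite /p /ladder_cycle cat_uniq rev_uniq !uniq_traj //=.
- rewrite andbT; apply/hasPn => w; rewrite mem_rev => /trajectP[j lt_jn ->{w}].
  apply/trajectP=> -[i lt_in]; rewrite iter_step_inv // => eq_ji.
  have avi := amb_inv az; rewrite -iter_step_inv // in eq_ji.
  have [lt_ij|le_ji] := ltnP i j.
    have /(congr1 GRing.inv) := iter_step_sub az avi (ltnW lt_ij) (esym eq_ji).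
    rewrite iter_step_inv // invrK; apply/eqP; case: (min_z (j - i)%N) => //.
    by rewrite subn_gt0 lt_ij (leq_ltn_trans (leq_subr _ _)).
  have := iter_step_sub avi az le_ji eq_ji.
  move: le_ji; rewrite leq_eqVlt => /orP[/eqP->|lt_ji].
    by rewrite subnn => /esym/eqP; rewrite (negPf (amb_inv_neq az)).
  apply/eqP; case: (min_z (i - j)%N) => //.
  by rewrite subn_gt0 lt_ji (leq_ltn_trans (leq_subr _ _)).
- exact: amb_inv.
- move=> m m_bd; rewrite iter_step_inv // (inj_eq invr_inj).
  by case: (min_z m m_bd).
- by move=> m /min_z[].
Qed.

Lemma traject_edge x m : amb x -> path coset_edge x (traject step (step x) m).
Proof.
by elim: m x => //= m IHm x ax; rewrite coset_edge_step //; apply/IHm/amb_step.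
Qed.

Lemma ladder_cycle_cycle : cycle coset_edge p.
Proof.
have avi := amb_inv az.
rewrite /p /ladder_cycle; case: n n_gt0 => //= m _.
rewrite rcons_cat cat_path traject_edge // last_traject /=.
rewrite lastI rev_rcons /= last_traject iter_step_inv //.
rewrite (coset_edge_inv (amb_iter m az)) /=.
rewrite rcons_path -iter_step_inv // -last_traject rev_path.
rewrite (eq_path (e' := coset_edge)); last by move=> x y; apply: coset_edge_sym.
rewrite traject_edge // (_ : last _ (rev _) = z^-1).
  by rewrite coset_edge_sym coset_edge_inv.
by case: (traject _ _ _) => //= y s; rewrite rev_cons last_rcons.
Qed.

End HamiltonianCycle.

(** * Connectedness of GL_2(Z)-classes *)

(** [Q] stands for any union of connected components of the graph with edges B
    and [step] on the ambiguous numbers; it is applied to the set of vertices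
    of a ladder. *)
Section Connectivity.
Variable Q : pred algC.
Hypothesis Q_inv : forall z, Q z^-1 = Q z.
Hypothesis Q_step : forall z, amb z -> Q (step z) = Q z.

Lemma invariant_opp z : amb z -> Q (- z) = Q z.
Proof.
have Qneg x : amb x -> x < 0 -> Q (- x) = Q x.
  move=> ax x_lt0; rewrite -[RHS]Q_step // -[LHS]Q_inv invrN.
  by case: (stepP ax) => // h _; rewrite (lt_gtF h) in x_lt0.
move=> az; case: (amb_signs az) => [[z_lt0 _]|[z_gt0 _]]; first exact: Qneg.
by rewrite -[in RHS](opprK z) [RHS]Qneg ?oppr_lt0 //; apply: amb_opp.
Qed.

(** Two steps from z are -1/z and then z - 1. *)
Lemma invariant_sub1 z : amb z -> z < 0 -> 1 < conj3 z -> Q (z - 1) = Q z.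
Proof.
move=> az z_lt0 cz_gt1; have cz_gt0 := lt_trans ltr01 cz_gt1.
rewrite -[RHS]Q_step // -[RHS]Q_step; last exact: amb_step.
rewrite [step z]/step z_lt0 /step oppr_lt0 invr_gt0 (lt_gtF z_lt0).
rewrite rmorphN fmorphV ltrN2 [1 < _]lt_gtF ?invf_lt1 //.
by rewrite invrN invrK opprD opprK addrC.
Qed.

(** Euclid's algorithm on the two rows, by induction on the sum m of the
    entries.  As w' = (a y' + b) / (c y' + d) is a quotient of positive numbers,
    subtracting the second row from the first keeps (w - 1)' positive, so w - 1
    is still ambiguous and two steps away from w.  Inversion exchanges the rows,
    and when the rows are not comparable the determinant leaves only the
    identity and the exchange matrix. *)
Lemma invariant_nonneg (m : nat) (a b c d : nat) y w :
  (a + b + c + d <= m)%N ->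
  (a * d == b * c + 1)%N || (b * c == a * d + 1)%N ->
  amb y -> y < 0 -> amb w -> w < 0 ->
  w * (c%:R * y + d%:R) = a%:R * y + b%:R -> Q w = Q y.
Proof.
elim: m a b c d w => [|m IHm] a b c d w le_m det_abcd ay y_lt0; first by nia.
have cy_gt0 := amb_lt0 ay y_lt0.
have affine_gt0 (k l : nat) : (0 < k + l)%N -> 0 < k%:R * conj3 y + l%:R.
  rewrite addn_gt0 -!(ltr0n algC) => /orP[k_gt0 | l_gt0].
    by rewrite ltr_wpDr ?mulr_gt0 ?ler0n.
  by rewrite ltr_wpDl ?mulr_ge0 ?ler0n // ltW.
(* The matrix with rows (a' + c', b' + d') and (c', d'): the first row dominates
   the second one. *)
have reduce (a' b' c' d' : nat) x :
    (a' + c' + (b' + d') + c' + d' <= m.+1)%N ->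
    ((a' + c') * d' == (b' + d') * c' + 1)%N
      || ((b' + d') * c' == (a' + c') * d' + 1)%N ->
    amb x -> x < 0 ->
    x * (c'%:R * y + d'%:R) = (a' + c')%:R * y + (b' + d')%:R -> Q x = Q y.
  move=> le_m' det' ax x_lt0 eq_x.
  have eq_x1 : (x - 1) * (c'%:R * y + d'%:R) = a'%:R * y + b'%:R.
    by rewrite mulrBl eq_x !natrD; ring.
  have ab_gt0 : (0 < a' + b')%N by nia.
  have cd_gt0 : (0 < c' + d')%N by nia.
  have cx1_gt0 : 0 < conj3 (x - 1).
    rewrite -(pmulr_lgt0 _ (affine_gt0 _ _ cd_gt0)).
    move/(congr1 conj3): eq_x1.
    rewrite rmorphM !rmorphD [conj3 (c'%:R * y)]rmorphM.
    rewrite [conj3 (a'%:R * y)]rmorphM.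
    by rewrite !rmorph_nat => ->; apply: affine_gt0.
  have cx_gt1 : 1 < conj3 x by rewrite -subr_gt0 -(rmorph1 conj3) -rmorphB.
  have x1_lt0 : x - 1 < 0 by rewrite ltrBlDr (lt_trans x_lt0) // add0r ltr01.
  rewrite -invariant_sub1 //; apply: IHm eq_x1 => //.
  - by lia.
  - by apply/orP; lia.
  - apply: amb_neg => //; rewrite -[x - 1]opprK opprB.
    by apply/Qsqrt3_opp/Qsqrt3_add1/Qsqrt3_opp; case: ax.
move=> aw w_lt0 eq_w.
have [/andP[le_ca le_db]|not_ge] := boolP ((c <= a) && (d <= b))%N.
  apply: (reduce (a - c)%N (b - d)%N c d); rewrite ?subnK //; lia.
have [/andP[le_ac le_bd]|not_le] := boolP ((a <= c) && (b <= d))%N.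
  rewrite -Q_inv; apply: (reduce (c - a)%N (d - b)%N a b);
    rewrite ?subnK //; try lia.
  - exact: amb_inv.
  - by rewrite invr_lt0.
  - by rewrite -eq_w mulrA mulVf ?mul1r // lt_eqF.
have : [|| [&& a == 1, b == 0, c == 0 & d == 1]
         | [&& a == 0, b == 1, c == 1 & d == 0]]%N.
  nia.
case/orP=> /and4P[/eqP defa /eqP defb /eqP defc /eqP defd].
  move: eq_w; rewrite defa defb defc defd.
  by rewrite mul0r add0r mulr1 mul1r addr0 => ->.
rewrite -Q_inv; move: eq_w.
rewrite defa defb defc defd mul0r !add0r mul1r addr0 => wy.
suff -> : w^-1 = y by [].
have w0 : w != 0 by rewrite lt_eqF.
by apply: (mulfI w0); rewrite mulfV ?wy.
Qed.

Lemma invariant_nonneg_int (a b c d : int) y w :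
  0 <= a -> 0 <= b -> 0 <= c -> 0 <= d ->
  a * d - b * c = 1 \/ a * d - b * c = -1 ->
  amb y -> y < 0 -> amb w -> w < 0 ->
  w * (c%:~R * y + d%:~R) = a%:~R * y + b%:~R -> Q w = Q y.
Proof.
case: a b c d => // a [] // b [] // c [] // d _ _ _ _ det_abcd.
by apply: (invariant_nonneg (leqnn _)); apply/orP; lia.
Qed.

Lemma affine_int_gt0 (k l : int) (x : algC) :
  0 <= k -> 0 <= l -> (k, l) != (0, 0) -> 0 < x -> 0 < k%:~R * x + l%:~R.
Proof.
move=> k_ge0 l_ge0 kl0 x_gt0.
move: k_ge0; rewrite le_eqVlt => /orP[/eqP k0 | k_gt0]; last first.
  by rewrite ltr_wpDr ?mulr_gt0 ?ler0z ?ltr0z.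
by move: kl0; rewrite -k0 xpair_eqE eqxx mul0r add0r ltr0z lt_def l_ge0 andbT.
Qed.

(** As ad and bc are consecutive integers, (ab)(cd) = (ad)(bc) is nonnegative,
    so ab and cd do not have strictly opposite signs.  If both are nonnegative,
    each row has a constant sign, and it is the same for both rows because y'
    and w' are positive: up to a global sign the matrix is nonnegative.  If both
    are nonpositive, negativity of y and w shows in the same way that the
    inverse matrix is nonnegative up to a global sign. *)
Lemma invariant_GL2Z_lt0 (a b c d : int) y w :
  a * d - b * c = 1 \/ a * d - b * c = -1 ->
  amb y -> y < 0 -> amb w -> w < 0 ->
  w * (c%:~R * y + d%:~R) = a%:~R * y + b%:~R -> Q w = Q y.
Proof.
move=> det_abcd ay y_lt0 aw w_lt0 eq_w.
have cy_gt0 := amb_lt0 ay y_lt0; have cw_gt0 := amb_lt0 aw w_lt0.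
have Ny_gt0 : 0 < - y by rewrite oppr_gt0.
have eq_cw : conj3 w * (c%:~R * conj3 y + d%:~R) = a%:~R * conj3 y + b%:~R.
  move/(congr1 conj3): eq_w.
  rewrite rmorphM !rmorphD [conj3 (c%:~R * y)]rmorphM.
  by rewrite [conj3 (a%:~R * y)]rmorphM !rmorph_int.
have eq_y : y * ((- c)%:~R * w + a%:~R) = d%:~R * w + (- b)%:~R.
  apply/eqP; rewrite -subr_eq0 !rmorphN /=.
  rewrite (_ : _ - _ = (a%:~R * y + b%:~R) - w * (c%:~R * y + d%:~R));
    last by ring.
  by rewrite eq_w subrr.
have ab0 : (a, b) != (0, 0) by apply/eqP=> -[a0 b0]; nia.
have cd0 : (c, d) != (0, 0) by apply/eqP=> -[c0 d0]; nia.
have signs_clash (x u v : algC) :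
    0 < x -> 0 < u -> 0 < v -> x * u = - v -> False.
  move=> x_gt0 u_gt0 v_gt0 xu; have := mulr_gt0 x_gt0 u_gt0.
  by rewrite xu oppr_gt0 (lt_gtF v_gt0).
have NNneq0 (k l : int) : (k, l) != (0, 0) -> (- k, - l) != (0, 0).
  by rewrite !xpair_eqE !oppr_eq0.
have Nlneq0 (k l : int) : (k, l) != (0, 0) -> (- k, l) != (0, 0).
  by rewrite !xpair_eqE !oppr_eq0.
have lNneq0 (k l : int) : (k, l) != (0, 0) -> (k, - l) != (0, 0).
  by rewrite !xpair_eqE !oppr_eq0.
have : 0 <= a * b /\ 0 <= c * d \/ a * b <= 0 /\ c * d <= 0.
  have abcd_ge0 : 0 <= (a * b) * (c * d) by nia.
  nia.
case=> [[ab_ge0 cd_ge0] | [ab_le0 cd_le0]].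
- have ab_sign : 0 <= a /\ 0 <= b \/ 0 <= - a /\ 0 <= - b by nia.
  have cd_sign : 0 <= c /\ 0 <= d \/ 0 <= - c /\ 0 <= - d by nia.
  case: ab_sign cd_sign => [] [a_s b_s] [] [c_s d_s].
  + exact: invariant_nonneg_int eq_w.
  + have row_cd := affine_int_gt0 c_s d_s (NNneq0 _ _ cd0) cy_gt0.
    case: (signs_clash _ _ _ cw_gt0 row_cd (affine_int_gt0 a_s b_s ab0 cy_gt0)).
    by rewrite -eq_cw !rmorphN /=; ring.
  + have row_ab := affine_int_gt0 a_s b_s (NNneq0 _ _ ab0) cy_gt0.
    case: (signs_clash _ _ _ cw_gt0 (affine_int_gt0 c_s d_s cd0 cy_gt0) row_ab).
    by rewrite eq_cw !rmorphN /=; ring.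
  + apply: (invariant_nonneg_int a_s b_s c_s d_s) => //; first by rewrite !mulrNN.
    by rewrite !rmorphN /= !mulNr -!opprD mulrN eq_w.
- have Nw_gt0 : 0 < - w by rewrite oppr_gt0.
  have ab_sign : 0 <= - a /\ 0 <= b \/ 0 <= a /\ 0 <= - b by nia.
  have cd_sign : 0 <= - c /\ 0 <= d \/ 0 <= c /\ 0 <= - d by nia.
  case: ab_sign cd_sign => [] [a_s b_s] [] [c_s d_s].
  + have row_cd := affine_int_gt0 c_s d_s (Nlneq0 _ _ cd0) Ny_gt0.
    have row_ab := affine_int_gt0 a_s b_s (Nlneq0 _ _ ab0) Ny_gt0.
    case: (signs_clash _ _ _ Nw_gt0 row_cd row_ab).
    by rewrite !rmorphN /= mulrNN (mulNr w) mulrNN eq_w.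
  + apply/esym/(invariant_nonneg_int d_s b_s c_s a_s) => //; first by lia.
    move: eq_y; rewrite !rmorphN /= => eq_y; apply: oppr_inj.
    by rewrite -mulrN !opprD -!mulNr !opprK eq_y.
  + apply/esym/(invariant_nonneg_int d_s b_s c_s a_s) => //; first by lia.
  + have row_cd := affine_int_gt0 c_s d_s (lNneq0 _ _ cd0) Ny_gt0.
    have row_ab := affine_int_gt0 a_s b_s (lNneq0 _ _ ab0) Ny_gt0.
    case: (signs_clash _ _ _ Nw_gt0 row_cd row_ab).
    by rewrite !rmorphN /= !mulrN -!opprD mulrNN eq_w opprK.
Qed.

(** Opposites reduce the signs of y and w to the negative ones. *)
Lemma invariant_GL2Z (a b c d : int) y w :
  a * d - b * c = 1 \/ a * d - b * c = -1 -> amb y -> amb w ->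
  w * (c%:~R * y + d%:~R) = a%:~R * y + b%:~R -> Q w = Q y.
Proof.
have norm x : amb x -> exists s : bool, let x' := (-1) ^+ s * x in
    [/\ amb x', x' < 0 & Q x' = Q x].
  move=> ax; case: (amb_signs ax) => [][h _].
    by exists false; rewrite expr0 mul1r.
  exists true; rewrite /= expr1 mulN1r oppr_lt0 invariant_opp //.
  by split=> //; apply: amb_opp.
move=> det_abcd /norm[s [ay y_lt0 <-]] /norm[t [aw w_lt0 <-]] eq_w.
apply: (@invariant_GL2Z_lt0 ((-1) ^+ s * (-1) ^+ t * a) ((-1) ^+ t * b)
                            ((-1) ^+ s * c) d) => //.
  clear -det_abcd; case: s t => [] [] /=;
    rewrite ?expr0 ?expr1 ?mul1r ?mulN1r ?opprK; lia.
clear -eq_w; case: s t => [] [] /=;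
  rewrite ?expr0 ?expr1 ?mul1r ?mulN1r ?opprK ?rmorphN /= ?mulrNN ?opprK //.
all: by rewrite mulNr eq_w opprD ?mulrN ?mulNr.
Qed.
End Connectivity.

(** * From Gaussian matrices to integer matrices *)

Lemma rect_eq0 (x y : algC) :
  x \is Num.real -> y \is Num.real -> x + 'i * y = 0 -> x = 0 /\ y = 0.
Proof.
move=> xR yR xy0; split.
  by rewrite -(Re_rect xR yR) xy0 raddf0.
by rewrite -(Im_rect xR yR) xy0 raddf0.
Qed.

Lemma gaussian_intP a :
  reflect (exists m n : int, a = m%:~R + 'i * n%:~R) (a \in gaussian_int).
Proof.
apply: (iffP andP) => [[/intrP[m defm] /intrP[n defn]] | [m [n ->]]].
  by exists m, n; rewrite [a]Crect defm defn.
by rewrite Re_rect ?Im_rect ?realz ?intr_int.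
Qed.

Lemma gaussian_affine_eq0 a b z :
  a \in gaussian_int -> b \in gaussian_int -> amb z -> a * z + b = 0 ->
  a = 0 /\ b = 0.
Proof.
move=> /gaussian_intP[a1 [a2 ->]] /gaussian_intP[b1 [b2 ->]] az eq0.
have zR := Qsqrt3_real (proj1 az).
have affine_real (m n : int) : m%:~R * z + n%:~R \is Num.real.
  by rewrite realD ?realM ?realz.
have irr := amb_conj3_neq az.
have [|] := rect_eq0 (affine_real a1 b1) (affine_real a2 b2).
  by rewrite -eq0; ring.
move=> /(int_affine_eq0 irr)[-> ->] /(int_affine_eq0 irr)[-> ->].
by rewrite !mulr0 addr0.
Qed.

Lemma gaussian_addr a b :
  a \in gaussian_int -> b \in gaussian_int -> a + b \in gaussian_int.
Proof.
move=> /gaussian_intP[m [n ->]] /gaussian_intP[k [l ->]].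
by apply/gaussian_intP; exists (m + k), (n + l); rewrite !rmorphD /=; ring.
Qed.

Lemma gaussian_mulr a b :
  a \in gaussian_int -> b \in gaussian_int -> a * b \in gaussian_int.
Proof.
move=> /gaussian_intP[m [n ->]] /gaussian_intP[k [l ->]].
apply/gaussian_intP; exists (m * k - n * l), (m * l + n * k).
have i2 : 'i ^+ 2 = -1 :> algC := sqrCi _.
rewrite !(rmorphD, rmorphN, rmorphM) /=.
have -> : - (n%:~R * l%:~R) = 'i ^+ 2 * (n%:~R * l%:~R) :> algC.
  by rewrite i2 mulN1r.
by ring.
Qed.

Lemma gaussian_imag n : 'i * n%:~R \in gaussian_int.
Proof. by apply/gaussian_intP; exists 0, n; rewrite add0r. Qed.

Lemma Picard_orbit_refl z : Picard_orbit z z.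
Proof.
have gint n : n%:~R \in gaussian_int.
  by apply/gaussian_intP; exists n, 0; rewrite mulr0 addr0.
exists (linear_fractional 1 0 0 1).
  exists 1, 0, 0, 1; split=> //; last by rewrite mulr1 mulr0 subr0.
  by rewrite (gint 1) (gint 0).
by rewrite /linear_fractional mul1r mul0r add0r addr0 divr1.
Qed.

Section PicardOrbit.
Variable alpha : algC.
Hypothesis a_alpha : amb alpha.

Lemma Picard_orbit_irr a b c d : c \in gaussian_int -> d \in gaussian_int ->
  a * d - b * c = 1 -> c * alpha + d != 0.
Proof.
move=> Gc Gd det1; apply/eqP=> /(gaussian_affine_eq0 Gc Gd a_alpha)[c0 d0].
by move/eqP: det1; rewrite c0 d0 !mulr0 subrr eq_sym oner_eq0.
Qed.

(** The transformation -z has determinant -1 over Z; multiplying its matrix by i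
    brings it back to 1.  The same holds for 1/z below. *)
Lemma Picard_orbit_opp z : Picard_orbit alpha z -> Picard_orbit alpha (- z).
Proof.
move=> [T [a [b [c [d [/and4P[Ga Gb Gc Gd] det1 defT]]]]] ->]; rewrite defT.
exists (linear_fractional ('i * a) ('i * b) (- 'i * c) (- 'i * d)).
  exists ('i * a), ('i * b), (- 'i * c), (- 'i * d).
  have Gi := gaussian_imag 1; have GNi := gaussian_imag (-1).
  rewrite mulr1 in Gi; rewrite mulrN1 in GNi; rewrite !gaussian_mulr //; split=> //.
  rewrite (_ : _ - _ = - 'i ^+ 2 * (a * d - b * c)); last by ring.
  by rewrite sqrCi det1 opprK mulr1.
rewrite /linear_fractional -!mulrA -!mulrDr mulNr invrN invfM mulrN; congr (- _).
by rewrite mulrCA !mulrA mulVf ?neq0Ci // mul1r mulrC.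
Qed.

Lemma Picard_orbit_inv z : Picard_orbit alpha z -> Picard_orbit alpha z^-1.
Proof.
move=> [T [a [b [c [d [/and4P[Ga Gb Gc Gd] det1 defT]]]]] ->]; rewrite defT.
exists (linear_fractional ('i * c) ('i * d) ('i * a) ('i * b)).
  exists ('i * c), ('i * d), ('i * a), ('i * b).
  have Gi := gaussian_imag 1; rewrite mulr1 in Gi.
  rewrite !gaussian_mulr //; split=> //.
  rewrite (_ : _ - _ = - 'i ^+ 2 * (a * d - b * c)); last by ring.
  by rewrite sqrCi det1 opprK mulr1.
rewrite /linear_fractional -!mulrA -!mulrDr invf_div invfM.
by rewrite mulrCA !mulrA mulVf ?neq0Ci // mul1r mulrC.
Qed.

Lemma Picard_orbit_add1 z : Picard_orbit alpha z -> Picard_orbit alpha (1 + z).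
Proof.
move=> [T [a [b [c [d [/and4P[Ga Gb Gc Gd] det1 defT]]]]] ->]; rewrite defT.
exists (linear_fractional (c + a) (d + b) c d).
  exists (c + a), (d + b), c, d; rewrite Gc Gd !gaussian_addr //; split=> //.
  by rewrite -[RHS]det1; ring.
have den0 := Picard_orbit_irr Gc Gd det1.
by rewrite /linear_fractional -{1}(divff den0) -mulrDl; congr (_ / _); ring.
Qed.

Lemma Picard_orbit_step z :
  amb z -> Picard_orbit alpha z -> Picard_orbit alpha (step z).
Proof.
apply: step_preserves => x ax; last by move=> _ _; apply: Picard_orbit_add1.
  exact: Picard_orbit_opp.
exact: Picard_orbit_inv.
Qed.

(** Write the matrix M1 + i M2 with M1, M2 integer, of determinants m1 and m2,
    and mu_k for the denominator of M_k at alpha.  Real and imaginary parts of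
    z = (M1 + i M2) alpha say that M1 and M2 both send the line of (alpha, 1)
    into the line of (z, 1), with factors mu1 and mu2; those of det = 1 say that
    m1 - m2 = 1 and that the polar form of the determinant vanishes at (M1, M2).
    Together they give m1 mu2^2 + m2 mu1^2 = 0 ([key]).  If m1 and m2 are
    nonzero, being consecutive integers they have the same sign, so
    mu1 = mu2 = 0, which the irrationality of alpha forbids.  So one of them is
    0, and then the other matrix has determinant 1 or -1. *)
Lemma Picard_orbit_real z : amb z -> Picard_orbit alpha z ->
  exists a b c d : int, [/\ a * d - b * c = 1 \/ a * d - b * c = -1 &
    z * (c%:~R * alpha + d%:~R) = a%:~R * alpha + b%:~R].
Proof.
move=> az [T [a [b [c [d [/and4P[Ga Gb Gc Gd] det1 defT]]]]] defz].
have den0 := Picard_orbit_irr Gc Gd det1.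
have {defz den0}eq_z : z * (c * alpha + d) = a * alpha + b.
  by rewrite defz defT /linear_fractional mulfVK.
move: Ga Gb Gc Gd => /gaussian_intP[a1 [a2 defa]] /gaussian_intP[b1 [b2 defb]]
  /gaussian_intP[c1 [c2 defc]] /gaussian_intP[d1 [d2 defd]].
have alphaR := Qsqrt3_real (proj1 a_alpha); have zR := Qsqrt3_real (proj1 az).
have i2 : 'i ^+ 2 = -1 :> algC := sqrCi _.
pose mu1 := c1%:~R * alpha + d1%:~R; pose mu2 := c2%:~R * alpha + d2%:~R.
have [eq1 eq2] : z * mu1 = a1%:~R * alpha + b1%:~R /\
                 z * mu2 = a2%:~R * alpha + b2%:~R.
  have affine_real (k l m n : int) :
      z * (k%:~R * alpha + l%:~R) - (m%:~R * alpha + n%:~R) \is Num.real.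
    by rewrite !(realB, realD, realM) ?realz.
  have [|/subr0_eq-> /subr0_eq->] :=
    rect_eq0 (affine_real c1 d1 a1 b1) (affine_real c2 d2 a2 b2); last by [].
  rewrite -[RHS](subrr (z * (c * alpha + d))) [in X in _ = _ - X]eq_z.
  by rewrite defa defb defc defd; ring.
pose m1 : int := a1 * d1 - b1 * c1; pose m2 : int := a2 * d2 - b2 * c2.
have [det_re polar0] : m1 - m2 - 1 = 0 /\
    a1 * d2 + a2 * d1 - b1 * c2 - b2 * c1 = 0.
  pose t : int := a1 * d2 + a2 * d1 - b1 * c2 - b2 * c1.
  have [|/eqP + /eqP] :=
    rect_eq0 (realz algC (m1 - m2 - 1)) (realz algC t); last first.
    by rewrite !intr_eq0 => /eqP det_re /eqP polar0.
  transitivity (a * d - b * c - 1); last by rewrite det1 subrr.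
  transitivity (m1%:~R + 'i ^+ 2 * m2%:~R - 1 + 'i * t%:~R : algC).
    by rewrite i2 mulN1r !rmorphB.
  rewrite defa defb defc defd /m1 /m2 /t !(rmorphB, rmorphD, rmorphM) /=.
  by ring.
have m1E : m1%:~R = mu1 * (a1%:~R - z * c1%:~R).
  rewrite (_ : _ * _ = a1%:~R * mu1 - (z * mu1) * c1%:~R); last by ring.
  by rewrite eq1 /m1 /mu1 rmorphB !rmorphM /=; ring.
have m2E : m2%:~R = mu2 * (a2%:~R - z * c2%:~R).
  rewrite (_ : _ * _ = a2%:~R * mu2 - (z * mu2) * c2%:~R); last by ring.
  by rewrite eq2 /m2 /mu2 rmorphB !rmorphM /=; ring.
have polarE : mu2 * (a1%:~R - z * c1%:~R) + mu1 * (a2%:~R - z * c2%:~R) = 0.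
  rewrite (_ : _ + _ = a1%:~R * mu2 - (z * mu1) * c2%:~R
                     + a2%:~R * mu1 - (z * mu2) * c1%:~R); last by ring.
  rewrite eq1 eq2 -[RHS](rmorph0 intr) -polar0 /mu1 /mu2.
  by rewrite !(rmorphB, rmorphD, rmorphM) /=; ring.
have key : m1%:~R * mu2 ^+ 2 + m2%:~R * mu1 ^+ 2 = 0.
  rewrite m1E m2E -[RHS](mulr0 (mu1 * mu2)) -polarE; ring.
have [m20|m2_neq0] := eqVneq m2 0.
  exists a1, b1, c1, d1; split=> //; left; rewrite -/m1; lia.
have [m10|m1_neq0] := eqVneq m1 0.
  exists a2, b2, c2, d2; split=> //; right; rewrite -/m2; lia.
have m12_gt0 : 0 < m1 * m2 by nia.
have mu1R : mu1 \is Num.real by rewrite realD ?realM ?realz.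
have mu2R : mu2 \is Num.real by rewrite realD ?realM ?realz.
have m12_gt0C : 0 < (m1 * m2)%:~R :> algC by rewrite ltr0z.
have sq1_ge0 : 0 <= (m1%:~R * mu2) ^+ 2.
  by rewrite real_exprn_even_ge0 // realM ?realz.
have sq2_ge0 : 0 <= (m1 * m2)%:~R * mu1 ^+ 2.
  by rewrite pmulr_rge0 // real_exprn_even_ge0.
have /eqP : (m1%:~R * mu2) ^+ 2 + (m1 * m2)%:~R * mu1 ^+ 2 = 0.
  by rewrite -[RHS](mulr0 m1%:~R) -key rmorphM /=; ring.
rewrite (paddr_eq0 sq1_ge0 sq2_ge0) sqrf_eq0 !mulf_eq0 intr_eq0.
rewrite (negPf m1_neq0) (gt_eqF m12_gt0C) orbb /=.
have irr := amb_conj3_neq a_alpha.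
case/andP=> /eqP/(int_affine_eq0 irr)[c20 d20].
move=> /eqP/(int_affine_eq0 irr)[c10 d10].
by rewrite /m1 c10 d10 !mulr0 subrr eqxx in m1_neq0.
Qed.
End PicardOrbit.

Theorem theorem1 (alpha : algC) (alpha_ambiguous : ambiguous alpha) :
  exists p : seq algC,
    closed_path_of_ambiguous alpha p /\
    (forall z : algC, Picard_orbit alpha z -> ambiguous z -> z \in p).
Proof.
have /ambiguousP a_alpha := alpha_ambiguous.
have [N N_gt0 N_period] := step_periodic a_alpha.
pose returns n := (0 < n)%N && (iter n step alpha \in [:: alpha; alpha^-1]).
have [|n /andP[n_gt0 iter_n] n_min] := @ex_minnP returns.
  by exists N; rewrite /returns N_gt0 N_period mem_head.
have before m : (0 < m < n)%N -> iter m step alpha \notin [:: alpha; alpha^-1].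
  case/andP=> m_gt0; apply: contraTN => m_ret; rewrite -leqNgt n_min //.
  by rewrite /returns m_gt0.
exists (ladder_cycle alpha n).
have alpha_in : alpha \in ladder_cycle alpha n.
  by apply/(mem_ladder_cycle _ a_alpha); exists 0%N => //; left.
split; last first.
  move=> z orb_z /ambiguousP az.
  have [a [b [c [d [det_abcd eq_z]]]]] := Picard_orbit_real a_alpha az orb_z.
  pose Q w := w \in ladder_cycle alpha n.
  suff -> : (z \in ladder_cycle alpha n) = (alpha \in ladder_cycle alpha n).
    exact: alpha_in.
  apply: (invariant_GL2Z (Q := Q) _ _ det_abcd a_alpha az eq_z).
    exact: ladder_cycle_inv.
  exact: ladder_cycle_step.
split; last by move=> z /(ladder_cycle_amb a_alpha) az; apply/ambiguousP.
split; first exact: ladder_cycle_size.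
  have orb_iter i : Picard_orbit alpha (iter i step alpha).
    elim: i => [|i IHi]; first exact: Picard_orbit_refl.
    by apply: Picard_orbit_step => //; apply: amb_iter.
  move=> z /(mem_ladder_cycle _ a_alpha)[i _ [->|def_z]] //.
  by rewrite -[z]invrK def_z; apply: Picard_orbit_inv.
apply/andP; split; first exact: ladder_cycle_cycle.
exact: ladder_cycle_uniq.
Qed.
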